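(* Let $P, Q \in \mathbb{Z}^{+}$ be the number of episodes and the number of query examples per episode, respectively. Let $a_1, \dots, a_P$ be random variables with values in $[0,1]$, where $a_p$ is the true accuracy of the evaluated method on episode $p \in \{1,\dots,P\}$, and for $p \in \{1,\dots,P\}$, $q \in \{1,\dots,Q\}$ let $X_{p,q} \in \{0,1\}$ be the indicator that the $q$-th query example of episode $p$ is classified correctly. Assume that the episodes are i.i.d., i.e. the random vectors $(a_p, X_{p,1}, \dots, X_{p,Q})$, $p = 1, \dots, P$, are independent and identically distributed, and that the query examples within an episode are i.i.d., i.e. for each $p$, conditionally on $a_p$, the variables $X_{p,1}, \dots, X_{p,Q}$ are independent and Bernoulli distributed with success probability $a_p$. Let $a = \mathbb{E}[a_p]$ and $\sigma_a^2 = \mathrm{Var}[a_p]$ be the mean and variance of $a_p$ over episodes. Define the empirical accuracy on episode $p$ and the final empirical accuracy by $$\tilde a_p = \frac{1}{Q}\sum_{q=1}^{Q} X_{p,q}, \qquad \tilde a = \frac{1}{P}\sum_{p=1}^{P} \tilde a_p .$$ Then, for any choice of $Q$ and $P$, $$\mathbb{E}[\tilde a] = a$$ and $$\mathrm{Var}[\tilde a] = \frac{1}{P}\left(\frac{1}{Q}\, a(1-a) + \left(1 - \frac{1}{Q}\right)\sigma_a^2\right).$$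
   Context: A classifier is evaluated over randomly drawn episodes. In each episode $p$ there is a fixed classifier whose true (unknown) accuracy is $a_p \in [0,1]$, i.e. the probability that a randomly drawn query example of that episode is classified correctly. Because the episode is random, $a_p$ is itself a random variable. The accuracy on an episode is estimated by the fraction of correctly classified examples among $Q$ independently drawn query examples, and the overall accuracy is estimated by averaging these fractions over $P$ independently drawn episodes. *)

(* Defs.v *)
From HB Require Import structures.
From mathcomp Require Import all_boot all_order all_algebra.
From mathcomp Require Import all_classical all_reals all_analysis.

Set Implicit Arguments.
Unset Strict Implicit.
Unset Printing Implicit Defensive.

Import Order.TTheory GRing.Theory Num.Theory.
Import numFieldNormedType.Exports.

Local Open Scope classical_set_scope.
Local Open Scope ring_scope.

Section independence.
Context d d' (T : measurableType d) (T' : measurableType d') (R : realType)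
  (mu : probability T R).

Definition mutually_independent (I : finType) (Z : I -> {RV mu >-> T'}) : Prop :=
  forall (J : {set I}) (B : I -> set T'),
    (forall i, measurable (B i)) ->
    mu (\bigcap_(i in [set` J]) (Z i @^-1` B i)) =
    (\prod_(i in J) mu (Z i @^-1` B i))%E.

(* The laws are compared on measurable sets only: [distribution mu Z] is a
   function on all sets, whose values elsewhere carry no information. *)
Definition identically_distributed (I : Type) (Z : I -> {RV mu >-> T'}) : Prop :=
  forall (i j : I) (B : set T'), measurable B ->
    distribution mu (Z i) B = distribution mu (Z j) B.

End independence.

Section conditioning.
Context d d1 (T : measurableType d) (T1 : measurableType d1) (R : realType)
  (mu : probability T R).

(* [g] is a version of the conditional probability P(E | Y). *)
Definition is_cond_prob (Y : {RV mu >-> T1}) (E : set T) (g : T -> R) : Prop :=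
  [/\ measurable_fun [set: g_sigma_algebra_preimageType Y] g,
      mu.-integrable [set: T] (EFin \o g) &
      forall A : set T, g_sigma_algebra_preimage Y A ->
        (\int[mu]_(w in A) (g w)%:E = mu (E `&` A))%E].

(* Versions exist and are almost surely unique, so asking for every choice of
   versions [g i] of P(Z i \in B i | Y) amounts to asking for one. *)
Definition cond_independent d2 (T2 : measurableType d2) (I : finType)
    (Y : {RV mu >-> T1}) (Z : I -> {RV mu >-> T2}) : Prop :=
  forall (J : {set I}) (B : I -> set T2) (g : I -> T -> R),
    (forall i, measurable (B i)) ->
    (forall i, is_cond_prob Y (Z i @^-1` B i) (g i)) ->
    is_cond_prob Y (\bigcap_(i in [set` J]) (Z i @^-1` B i))
      (fun w => \prod_(i in J) g i w).

End conditioning.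

Definition cond_bernoulli d (T : measurableType d) (R : realType)
    (mu : probability T R) (Y : {RV mu >-> R}) (X : {RV mu >-> bool}) : Prop :=
  forall B : set bool, measurable B ->
    is_cond_prob Y (X @^-1` B) (fun w => fine (bernoulli_prob (Y w) B)).

Section episodes.
Context d (T : measurableType d) (R : realType) (mu : probability T R).

Definition episode_vector (Q : nat) (a : {RV mu >-> R})
    (X : 'I_Q -> {RV mu >-> bool}) (w : T) : R * Q.-tuple bool :=
  (a w, [tuple X q w | q < Q]).

Lemma measurable_episode_vector (Q : nat) (a : {RV mu >-> R})
    (X : 'I_Q -> {RV mu >-> bool}) :
  measurable_fun [set: T] (episode_vector a X).
Proof.
apply: measurable_fun_pair => //.
apply/measurable_fun_tnthP => q.
rewrite (_ : _ \o _ = X q) //.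
by apply/funext => w /=; rewrite tnth_mktuple.
Qed.

HB.instance Definition _ (Q : nat) (a : {RV mu >-> R})
    (X : 'I_Q -> {RV mu >-> bool}) :=
  isMeasurableFun.Build _ _ _ _ (episode_vector a X)
    (measurable_episode_vector a X).

Definition episode_RV (Q : nat) (a : {RV mu >-> R})
    (X : 'I_Q -> {RV mu >-> bool}) : {RV mu >-> (R * Q.-tuple bool)%type} :=
  episode_vector a X.

Definition episode_accuracy (Q : nat) (X : 'I_Q -> {RV mu >-> bool}) : T -> R :=
  fun w => Q%:R^-1 * \sum_(q < Q) (X q w)%:R.

Definition overall_accuracy (P Q : nat) (X : 'I_P -> 'I_Q -> {RV mu >-> bool}) :
    T -> R :=
  fun w => P%:R^-1 * \sum_(p < P) episode_accuracy (X p) w.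

End episodes.

(* Main.v *)
(* The overall accuracy is 1/(PQ) times the sum of the indicators of the events
   E_(p,q) = {X_(p,q) = 1}, so its first two moments only depend on the
   probabilities of E_(p,q) and of the intersections of two such events.
   Integrating the conditional probabilities given a_p over the whole space
   gives mu(E_(p,q)) = E[a_p] = m, and mu(E_(p,q) & E_(p,q')) = E[a_p^2] = s for
   q != q'; independence of the episodes gives m^2 when the episodes differ.
   Counting the three kinds of pairs yields the variance. *)
Require Import Defs.
From mathcomp Require Import all_boot all_order all_algebra.
From mathcomp Require Import all_classical all_reals all_analysis.
From mathcomp Require Import ring.

Set Implicit Arguments.
Unset Strict Implicit.

Import Order.TTheory GRing.Theory Num.Theory.
Import numFieldNormedType.Exports.

Local Open Scope classical_set_scope.
Local Open Scope ring_scope.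

Section scaled_indicator_sums.
Context (d : measure_display) (T : measurableType d) (R : realType)
  (mu : probability T R).

Lemma integrable_sum_indic (I : finType) (E : I -> set T) (c : R) :
  (forall i, measurable (E i)) ->
  mu.-integrable [set: T] (fun w => (c * \sum_i \1_(E i) w)%:E).
Proof.
move=> mE.
under eq_fun do rewrite EFinM -sumEFin.
apply: integrableZl => //.
apply: integrable_sum => // i _.
exact: integrable_indic.
Qed.

Lemma expectation_sum_indic (I : finType) (E : I -> set T) (c : R) :
  (forall i, measurable (E i)) ->
  'E_mu[(fun w => c * \sum_i \1_(E i) w)%R]%E = (c * \sum_i fine (mu (E i)))%:E.
Proof.
move=> mE; rewrite unlock.
under eq_integral do rewrite EFinM -sumEFin.
have iE i : mu.-integrable [set: T] (fun w => (\1_(E i) w)%:E).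
  exact: integrable_indic.
rewrite integralZl//; last exact: integrable_sum.
rewrite integral_sum// EFinM -sumEFin; congr (_ * _)%E; apply: eq_bigr => i _.
by rewrite integral_indic// setIT fineK ?fin_num_measure.
Qed.

(** The square of a sum of indicators is again a sum of indicators, of the pairwise intersections,
    indexed by [I * I]; so the second moment is another instance of [expectation_sum_indic]. *)
Lemma variance_sum_indic (I : finType) (E : I -> set T) (c : R) :
  (forall i, measurable (E i)) ->
  'V_mu[(fun w => c * \sum_i \1_(E i) w)%R]%E =
  (c ^+ 2 * (\sum_i \sum_j fine (mu (E i `&` E j)) -
             (\sum_i fine (mu (E i))) ^+ 2))%:E.
Proof.
move=> mE; set f := fun w => _.
have ff : (f * f)%R =
    fun w => c ^+ 2 * \sum_(ij : I * I) \1_(E ij.1 `&` E ij.2) w.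
  apply/funext => w; rewrite /f /= /GRing.mul /= mulrACA -expr2; congr (_ * _).
  rewrite big_distrlr/= pair_bigA/=; apply: eq_bigr => ij _.
  by rewrite indicI.
have mEE (ij : I * I) : measurable (E ij.1 `&` E ij.2) by exact: measurableI.
have fL1 : f \in Lfun mu 1.
  by apply/Lfun1_integrable; exact: integrable_sum_indic.
have ffL1 : (f * f)%R \in Lfun mu 1.
  by rewrite ff; apply/Lfun1_integrable; exact: integrable_sum_indic.
rewrite /variance covarianceE// ff !expectation_sum_indic// -EFinM -EFinB.
by rewrite (pair_bigA _ (fun i j => fine (mu (E i `&` E j))))/=; congr EFin; ring.
Qed.

End scaled_indicator_sums.

Section conditional_probability.
Context (d d1 : measure_display) (T : measurableType d) (T1 : measurableType d1)
  (R : realType) (mu : probability T R).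

(** The whole space is the preimage of [setT] under [Y], so it is an admissible [A] in the defining
    property. *)
Lemma is_cond_prob_integral (Y : {RV mu >-> T1}) (E : set T) (g : T -> R) :
  is_cond_prob Y E g -> (\int[mu]_w (g w)%:E = mu E)%E.
Proof.
move=> [_ _ gE]; rewrite gE ?setIT//.
by exists setT => //; rewrite setTI preimage_setT.
Qed.

End conditional_probability.

Lemma bernoulli_prob_true (R : realType) (r : R) :
  0 <= r <= 1 -> bernoulli_prob r [set true] = r%:E.
Proof. by move=> r01; rewrite /bernoulli_prob r01 fsbig_set1. Qed.

Lemma bigcap_finset2 (T : Type) (I : finType) (F : I -> set T) (i j : I) :
  \bigcap_(k in [set` [set i; j]%SET]) F k = F i `&` F j.
Proof.
apply/seteqP; split=> [w Fw|w [Fi Fj] k /=].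
  by split; apply: Fw; rewrite /= !inE eqxx ?orbT.
by rewrite !inE => /orP[] /eqP ->.
Qed.

Section pairs.
Context (d d' d1 : measure_display) (T : measurableType d)
  (T' : measurableType d') (T1 : measurableType d1) (R : realType)
  (mu : probability T R).

Lemma mutually_independent_pair (I : finType) (Z : I -> {RV mu >-> T'})
    (i j : I) (A B : set T') :
  mutually_independent Z -> i != j -> measurable A -> measurable B ->
  mu (Z i @^-1` A `&` Z j @^-1` B) =
  (mu (Z i @^-1` A) * mu (Z j @^-1` B))%E.
Proof.
move=> indep ij mA mB.
have ji : (j == i) = false by rewrite eq_sym (negbTE ij).
(* Independence expects an event for every index; only the values at [i] and [j] matter for the
   subset [{i, j}]. *)
have mC k : measurable (if k == i then A else B) by case: ifP.
have := indep [set i; j]%SET (fun k => if k == i then A else B) mC.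
by rewrite bigcap_finset2 eqxx ji => ->; rewrite big_setU1 ?inE//= big_set1 eqxx ji.
Qed.

(** One [g] serves all indices, so the product of versions over two of them is a square; with [g]
    the true accuracy, its integral is a second moment. *)
Lemma cond_independent_pair (I : finType) (Y : {RV mu >-> T1})
    (Z : I -> {RV mu >-> T'}) (i j : I) (B : set T') (g : T -> R) :
  cond_independent Y Z -> i != j -> measurable B ->
  (forall k, is_cond_prob Y (Z k @^-1` B) g) ->
  is_cond_prob Y (Z i @^-1` B `&` Z j @^-1` B) (fun w => g w * g w).
Proof.
move=> indep ij mB gP.
have := indep [set i; j]%SET (fun=> B) (fun=> g) (fun=> mB) gP.
rewrite bigcap_finset2 (_ : (fun w => \prod_(i in _) _) = fun w => g w * g w)//.
by apply/funext => w; rewrite big_setU1 ?inE//= big_set1.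
Qed.

End pairs.

Section episode_events.
Context (d : measure_display) (T : measurableType d) (R : realType)
  (mu : probability T R) (Q : nat).

(** The assumptions across episodes concern whole episode vectors, so a correct answer is recast as
    an event about such a vector. *)
Definition answer_correct (q : 'I_Q) : set (R * Q.-tuple bool) :=
  [set v | tnth v.2 q = true].

Lemma measurable_answer_correct (q : 'I_Q) : measurable (answer_correct q).
Proof.
have mf : measurable_fun [set: R * Q.-tuple bool] (fun v => tnth v.2 q).
  exact: (measurableT_comp (measurable_tnth q) measurable_snd).
rewrite -[answer_correct q]setTI; exact: (mf measurableT [set true]).
Qed.

Lemma preimage_answer_correct (a : {RV mu >-> R}) (X : 'I_Q -> {RV mu >-> bool})
    (q : 'I_Q) :
  episode_RV a X @^-1` answer_correct q = X q @^-1` [set true].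
Proof.
by apply/seteqP; split=> w; rewrite /answer_correct /= tnth_mktuple.
Qed.

End episode_events.

(** Every row has the same sum: one diagonal entry, [Q - 1] entries in the same block and
    [(P - 1) Q] in the other blocks. *)
Lemma sum_block_constant (R : comNzRingType) (P Q : nat) (m s t : R)
    (F : 'I_P * 'I_Q -> 'I_P * 'I_Q -> R) :
  (forall p q, F (p, q) (p, q) = m) ->
  (forall p q q', q != q' -> F (p, q) (p, q') = s) ->
  (forall p p' q q', p != p' -> F (p, q) (p', q') = t) ->
  \sum_i \sum_j F i j =
  P%:R * Q%:R * (m + (Q%:R - 1) * s + (P%:R - 1) * Q%:R * t).
Proof.
move=> Fm Fs Ft.
have inner i : \sum_j F i j = m + (Q%:R - 1) * s + (P%:R - 1) * Q%:R * t.
  case: i => p q.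
  (* The row index itself witnesses that [P] and [Q] are positive, so their predecessors cast to
     true subtractions in [R]. *)
  have P0 : (0 < P)%N by case: (P) p => [[]|].
  have Q0 : (0 < Q)%N by case: (Q) q => [[]|].
  transitivity (\sum_p' \sum_q' F (p, q) (p', q')).
    by rewrite pair_bigA/=; apply: eq_bigr => -[].
  rewrite (bigD1 p)//= (bigD1 q)//= Fm.
  under eq_bigr do rewrite Fs 1?eq_sym//.
  under [X in _ + X]eq_bigr => p' pp'.
    under eq_bigr do rewrite Ft 1?eq_sym//.
    rewrite sumr_const card_ord.
    over.
  rewrite !sumr_const !cardC1 !card_ord -[s *+ _]mulr_natr.
  rewrite -[_ *+ P.-1]mulr_natr -[t *+ Q]mulr_natr.
  rewrite -(subn1 Q) -(subn1 P) !natrB//.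
  by ring.
under eq_bigr do rewrite inner.
by rewrite sumr_const card_prod !card_ord -[_ *+ (P * Q)]mulr_natl natrM.
Qed.

Theorem theorem1 (d : measure_display) (T : measurableType d) (R : realType)
    (mu : probability T R) (P Q : nat)
    (a : 'I_P -> {RV mu >-> R}) (X : 'I_P -> 'I_Q -> {RV mu >-> bool})
    (P_gt0 : (0 < P)%N) (Q_gt0 : (0 < Q)%N)
    (a01 : forall p w, 0 <= a p w <= 1)
    (episodes_indep : mutually_independent (fun p => episode_RV (a p) (X p)))
    (episodes_id : identically_distributed (fun p => episode_RV (a p) (X p)))
    (queries_indep : forall p, cond_independent (a p) (X p))
    (queries_bernoulli : forall p q, cond_bernoulli (a p) (X p q)) :
  forall p : 'I_P,
    let abar := 'E_mu[a p]%E in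
    let sigma2 := 'V_mu[a p]%E in
    ('E_mu[overall_accuracy X] = abar)%E /\
    ('V_mu[overall_accuracy X] =
      (P%:R^-1)%:E *
        ((Q%:R^-1)%:E * (abar * (1 - abar)) + (1 - Q%:R^-1)%:E * sigma2))%E.
Proof.
move=> p abar sigma2.
have mtrue : measurable [set true] by [].
have condX p' q : is_cond_prob (a p') (X p' q @^-1` [set true]) (a p').
  have := queries_bernoulli p' q _ mtrue.
  rewrite (_ : (fun w => fine _) = a p')//.
  by apply/funext => w; rewrite bernoulli_prob_true.
(* Integrability is part of being a version; [Q_gt0] supplies a query to read it from. *)
have aL1 : (a p : T -> R) \in Lfun mu 1.
  apply/Lfun1_integrable.
  by have [_ ? _] := condX p (Ordinal Q_gt0).
have aaL1 : ((a p : T -> R) * (a p : T -> R)) \in Lfun mu 1.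
  apply/Lfun1_integrable/measurable_bounded_integrable => //.
  - by rewrite (le_lt_trans (probability_le1 mu _))// ltry.
  - exact: measurable_realfun.measurable_funM.
  exists 1; split => // M M1 w _ /=.
  have /andP[a0 a1] := a01 p w.
  by rewrite ger0_norm ?mulr_ge0// (le_trans _ (ltW M1))// mulr_ile1.
have abarE : abar = (fine abar)%:E by rewrite fineK// expectation_fin_num.
have aaE := fineK (expectation_fin_num aaL1).
have sigma2E : sigma2 =
    (fine 'E_mu[(a p : T -> R) * (a p : T -> R)]%E - fine abar ^+ 2)%:E.
  by rewrite /sigma2 /variance covarianceE// -aaE -/abar abarE.
set m := fine abar in abarE sigma2E.
set s := fine 'E_mu[_]%E in sigma2E aaE.
pose E (i : 'I_P * 'I_Q) := X i.1 i.2 @^-1` [set true].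
have mE i : measurable (E i) by exact: measurable_funPTI.
have EE i : E i = episode_RV (a i.1) (X i.1) @^-1` answer_correct i.2.
  by rewrite preimage_answer_correct.
have muE i : mu (E i) = m%:E.
  (* Equality of laws moves the event to the fixed episode [p], whose moments define [m] and [s]. *)
  rewrite EE -[LHS](episodes_id p); last exact: measurable_answer_correct.
  rewrite /distribution /pushforward preimage_answer_correct.
  by rewrite -(is_cond_prob_integral (condX _ _)) -abarE /abar unlock.
have muEE_same p' q q' : q != q' -> mu (E (p', q) `&` E (p', q')) = s%:E.
  move=> qq'; rewrite !EE/= -preimage_setI.
  rewrite -[LHS](episodes_id p); last first.
    by apply: measurableI; exact: measurable_answer_correct.
  rewrite /distribution /pushforward preimage_setI !preimage_answer_correct.
  have c2 := cond_independent_pair (queries_indep p) qq'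
    mtrue (condX p).
  by rewrite -(is_cond_prob_integral c2) aaE unlock.
have muEE_diff p1 p2 q q' : p1 != p2 ->
    mu (E (p1, q) `&` E (p2, q')) = (m ^+ 2)%:E.
  move=> p12; rewrite expr2 EFinM -{1}(muE (p1, q)) -(muE (p2, q')) !EE/=.
  by rewrite (mutually_independent_pair episodes_indep p12)//;
    exact: measurable_answer_correct.
have accE : overall_accuracy X = fun w => (P%:R * Q%:R)^-1 * \sum_i \1_(E i) w.
  apply/funext => w; rewrite /overall_accuracy /episode_accuracy.
  rewrite -big_distrr/= mulrA -invfM; congr (_ * _).
  rewrite pair_bigA/=; apply: eq_bigr => i _; rewrite indicE /E.
  by case Xw: (X i.1 i.2 w); [rewrite mem_set|rewrite memNset/= ?Xw].
have P0 : P%:R != 0 :> R by rewrite pnatr_eq0 -lt0n.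
have Q0 : Q%:R != 0 :> R by rewrite pnatr_eq0 -lt0n.
have sumE : \sum_i fine (mu (E i)) = P%:R * Q%:R * m.
  under eq_bigr do rewrite muE.
  by rewrite sumr_const card_prod !card_ord -[_ *+ (P * Q)]mulr_natl natrM.
rewrite accE expectation_sum_indic// variance_sum_indic// sumE; split.
  by rewrite abarE mulKf// mulf_neq0.
rewrite (@sum_block_constant _ P Q m s (m ^+ 2)); first last.
- by move=> p1 p2 q q' /muEE_diff->.
- by move=> p' q q' /muEE_same->.
- by move=> p' q; rewrite setIid muE.
(* Both sides reduce to [(m + (Q - 1) s - Q m^2) / (P Q)]. *)
rewrite abarE sigma2E -!(EFinM, EFinB, EFinD); congr EFin; field.
by rewrite P0 Q0.
Qed.
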